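(* Let $M$ be a smooth manifold with a Riemannian metric $\alpha=\sqrt{\alpha_{ij}(x)y^iy^j}$ and a $1$-form $\beta=b_i(x)y^i$, and let $F=\alpha\,(s^2-s-1)$, $s=\beta/\alpha$, be the golden $(\alpha,\beta)$-metric. The spray coefficients $G^i$ of $F$ are given by $$G^i=G^i_\alpha+\alpha\,Q\,s^i{}_0+(-2\alpha\,Q\,s_0+r_{00})\big(\Psi\,b^i+\Theta\,\alpha^{-1}y^i\big),$$ where $$Q(s)=\frac{1-2s}{s^2+1},\qquad \Theta(s)=-\frac{(s-1)(4s^2+s+1)}{2(s^2-s-1)\,z(s)},\qquad \Psi(s)=\frac{1}{z(s)},\qquad z(s)=2b^2-3s^2-1.$$
   Context: Notation: $(\alpha^{ij})$ is the inverse matrix of $(\alpha_{ij})$, $b^i=\alpha^{ij}b_j$, $b^2=\alpha^{ij}b_ib_j$. $G^i_\alpha$ are the spray coefficients of $\alpha$, and $b_{i|j}$ denotes the covariant derivative of $\beta$ with respect to the Levi-Civita connection of $\alpha$. Put $r_{ij}=\frac12(b_{i|j}+b_{j|i})$, $s_{ij}=\frac12(b_{i|j}-b_{j|i})$, $s^i{}_j=\alpha^{ih}s_{hj}$, $s_j=b^is_{ij}$; the index $0$ means contraction with $y$, e.g. $s^i{}_0=s^i{}_jy^j$, $s_0=s_iy^i$, $r_{00}=r_{ij}y^iy^j$. The spray coefficients of a Finsler metric $F$ with metric tensor $g_{ij}=\frac12\frac{\partial^2F^2}{\partial y^i\partial y^j}$ are $G^i=\frac14g^{il}\left(\frac{\partial^2F^2}{\partial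 x^k\partial y^l}y^k-\frac{\partial F^2}{\partial x^l}\right)$, so that geodesics satisfy $\ddot x^i+2G^i(x,\dot x)=0$. Everything is considered at points $(x,y)$, $y\neq0$, where the golden metric is a Finsler metric, in particular $s^2-s-1\neq0$ and $z(s)\neq0$. *)

(* Defs.v *)
From HB Require Import structures.
From mathcomp Require Import all_boot all_order all_algebra.
From mathcomp Require Import all_classical all_reals all_analysis.

Set Implicit Arguments.
Unset Strict Implicit.
Unset Printing Implicit Defensive.

Import Order.TTheory GRing.Theory Num.Theory.
Import numFieldNormedType.Exports.

Local Open Scope classical_set_scope.
Local Open Scope ring_scope.

Definition partial (R : realType) (n : nat) (i : 'I_n) (f : 'rV[R]_n -> R)
  (x : 'rV[R]_n) : R := 'D_(delta_mx 0 i) f x.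

(** C^k and C^oo real functions on an open set [U] *)
Fixpoint Ck_on (R : realType) (n k : nat) (U : set 'rV[R]_n)
  (f : 'rV[R]_n -> R) : Prop :=
  match k with
  | 0%N => forall x, U x -> {for x, continuous f}
  | k'.+1 => [/\ forall x, U x -> {for x, continuous f},
                 forall (i : 'I_n) x, U x -> derivable f x (delta_mx 0 i)
               & forall i : 'I_n, Ck_on k' U (partial i f)]
  end.

Definition smooth_on (R : realType) (n : nat) (U : set 'rV[R]_n)
  (f : 'rV[R]_n -> R) : Prop := forall k, Ck_on k U f.

(** * Smooth manifolds *)

(** [chart_inv] is only meaningful on [chart_map @` chart_dom]. *)
Record chart (R : realType) (T : topologicalType) (n : nat) := Chart {
  chart_dom : set T ;
  chart_map : T -> 'rV[R]_n ;
  chart_inv : 'rV[R]_n -> T ;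
  chart_dom_open : open chart_dom ;
  chart_img_open : open (chart_map @` chart_dom) ;
  chart_mapK : forall p, chart_dom p -> chart_inv (chart_map p) = p ;
  chart_map_continuous : {within chart_dom, continuous chart_map} ;
  chart_inv_continuous :
    {within chart_map @` chart_dom, continuous chart_inv}
}.

Definition chart_img (R : realType) (T : topologicalType) (n : nat)
  (c : chart R T n) : set 'rV[R]_n := chart_map c @` chart_dom c.

Definition transition (R : realType) (T : topologicalType) (n : nat)
  (c c' : chart R T n) (x : 'rV[R]_n) : 'rV[R]_n :=
  chart_map c' (chart_inv c x).

Record smoothManifold (R : realType) (n : nat) := SmoothManifold {
  space :> topologicalType ;
  space_hausdorff : hausdorff_space space ;
  space_second_countable : @second_countable space ;
  atlas : set (chart R space n) ;
  atlas_cover : forall p, exists2 c, atlas c & chart_dom c p ;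
  atlas_smooth : forall c c', atlas c -> atlas c' -> forall k : 'I_n,
    smooth_on (chart_map c @` (chart_dom c `&` chart_dom c'))
              (fun x => transition c c' x 0 k)
}.

(** [transition_jac c c' x k i] is d x'^k / d x^i at the point of coordinates
    [x] in the chart [c], where x' are the coordinates of the chart [c']. *)
Definition transition_jac (R : realType) (T : topologicalType) (n : nat)
  (c c' : chart R T n) (x : 'rV[R]_n) (k i : 'I_n) : R :=
  partial i (fun u => transition c c' u 0 k) x.

(** Tensor fields are given by their components in every chart of the atlas,
    subject to the tensorial transformation law. *)
Record riemannianMetric (R : realType) (n : nat) (M : smoothManifold R n) :=
  RiemannianMetric {
  metric_comp :> chart R M n -> 'rV[R]_n -> 'M[R]_n ;
  metric_smooth : forall c, atlas c -> forall i j : 'I_n,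
    smooth_on (chart_img c) (fun x => metric_comp c x i j) ;
  metric_sym : forall c x, atlas c -> chart_img c x ->
    forall i j : 'I_n, metric_comp c x i j = metric_comp c x j i ;
  metric_posdef : forall c x, atlas c -> chart_img c x ->
    forall v : 'rV[R]_n, v != 0 ->
    0 < \sum_i \sum_j metric_comp c x i j * v 0 i * v 0 j ;
  metric_change : forall c c' p, atlas c -> atlas c' ->
    chart_dom c p -> chart_dom c' p -> forall i j : 'I_n,
    let x := chart_map c p in
    metric_comp c x i j =
    \sum_k \sum_l transition_jac c c' x k i * transition_jac c c' x l j
                  * metric_comp c' (chart_map c' p) k l
}.

Record oneForm (R : realType) (n : nat) (M : smoothManifold R n) := OneForm {
  form_comp :> chart R M n -> 'rV[R]_n -> 'rV[R]_n ;
  form_smooth : forall c, atlas c -> forall i : 'I_n,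
    smooth_on (chart_img c) (fun x => form_comp c x 0 i) ;
  form_change : forall c c' p, atlas c -> atlas c' ->
    chart_dom c p -> chart_dom c' p -> forall i : 'I_n,
    let x := chart_map c p in
    form_comp c x 0 i =
    \sum_k transition_jac c c' x k i * form_comp c' (chart_map c' p) 0 k
}.

(** * Spray coefficients, in local coordinates (x, y) of the tangent bundle *)

Definition fundamental_tensor (R : realType) (n : nat)
  (F : 'rV[R]_n -> 'rV[R]_n -> R) (x y : 'rV[R]_n) : 'M[R]_n :=
  \matrix_(i, j) (2^-1 * partial i (partial j (fun v => F x v ^+ 2)) y).

Definition spray (R : realType) (n : nat)
  (F : 'rV[R]_n -> 'rV[R]_n -> R) (x y : 'rV[R]_n) (i : 'I_n) : R :=
  4^-1 * \sum_l invmx (fundamental_tensor F x y) i l *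
    (\sum_k partial k (fun u => partial l (fun v => F u v ^+ 2) y) x * y 0 k
     - partial l (fun u => F u y ^+ 2) x).

(** * The golden (alpha, beta)-metric; [a] and [b] are the components of
    alpha and beta in a chart *)
Section GoldenMetric.
Variables (R : realType) (n : nat).
Variables (a : 'rV[R]_n -> 'M[R]_n) (b : 'rV[R]_n -> 'rV[R]_n).

Definition alpha_norm (x y : 'rV[R]_n) : R :=
  Num.sqrt (\sum_i \sum_j a x i j * y 0 i * y 0 j).

Definition beta_eval (x y : 'rV[R]_n) : R := \sum_i b x 0 i * y 0 i.

Definition ab_ratio (x y : 'rV[R]_n) : R := beta_eval x y / alpha_norm x y.

Definition golden_metric (x y : 'rV[R]_n) : R :=
  alpha_norm x y * (ab_ratio x y ^+ 2 - ab_ratio x y - 1).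

Definition b_up (x : 'rV[R]_n) (i : 'I_n) : R :=
  \sum_j invmx (a x) i j * b x 0 j.

Definition b_sq (x : 'rV[R]_n) : R :=
  \sum_i \sum_j invmx (a x) i j * b x 0 i * b x 0 j.

Definition christoffel (x : 'rV[R]_n) (k i j : 'I_n) : R :=
  2^-1 * \sum_l invmx (a x) k l *
    (partial i (fun u => a u j l) x + partial j (fun u => a u i l) x
     - partial l (fun u => a u i j) x).

(** [b_cov x i j] is b_{i|j}: the second index is the one of differentiation. *)
Definition b_cov (x : 'rV[R]_n) (i j : 'I_n) : R :=
  partial j (fun u => b u 0 i) x - \sum_k christoffel x k i j * b x 0 k.

Definition r_dd (x : 'rV[R]_n) (i j : 'I_n) : R :=
  2^-1 * (b_cov x i j + b_cov x j i).

Definition s_dd (x : 'rV[R]_n) (i j : 'I_n) : R :=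
  2^-1 * (b_cov x i j - b_cov x j i).

Definition s_ud (x : 'rV[R]_n) (i j : 'I_n) : R :=
  \sum_h invmx (a x) i h * s_dd x h j.

Definition s_d (x : 'rV[R]_n) (j : 'I_n) : R :=
  \sum_i b_up x i * s_dd x i j.

Definition s_u0 (x y : 'rV[R]_n) (i : 'I_n) : R :=
  \sum_j s_ud x i j * y 0 j.

Definition s_0 (x y : 'rV[R]_n) : R := \sum_i s_d x i * y 0 i.

Definition r_00 (x y : 'rV[R]_n) : R :=
  \sum_i \sum_j r_dd x i j * y 0 i * y 0 j.

End GoldenMetric.

(** Below, [b2] is the value of b^2 at the base point. *)
Definition golden_z (R : realType) (b2 s : R) : R :=
  2 * b2 - 3 * s ^+ 2 - 1.

Definition golden_Q (R : realType) (s : R) : R :=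
  (1 - 2 * s) / (s ^+ 2 + 1).

Definition golden_Theta (R : realType) (b2 s : R) : R :=
  - ((s - 1) * (4 * s ^+ 2 + s + 1)
     / (2 * (s ^+ 2 - s - 1) * golden_z b2 s)).

Definition golden_Psi (R : realType) (b2 s : R) : R := (golden_z b2 s)^-1.

(* Main.v *)
(** Write [A] = alpha^2, [B] = beta and F^2 = P(A, B). With Y_i = alpha_ij y^j
    the fundamental tensor is
      g = P_A alpha_ij + 2 P_AA Y Y + P_AB (Y b + b Y) + P_BB/2 b b,
    and the Euler-Lagrange expression E_l of F^2 (so that G = g^-1 E / 4)
    satisfies
      E - 4 g G_alpha = 2 P_AB r_00 Y + P_BB r_00 b + 2 P_B s_{l0}.
    As g maps s^i_0, b^i and y^i to combinations of s_{l0}, b_l and Y_l, the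
    claimed G solves 4 g G = E by a rational identity in s, alpha and b^2.
    Contracting g v = 0 with y and with b^i gives a 2x2 linear system for
    (Y.v, b.v) whose determinant is a nonzero multiple of phi^2 z, whence g is
    invertible. *)

Require Import Defs.
From HB Require Import structures.
From mathcomp Require Import all_boot all_order all_algebra.
From mathcomp Require Import all_classical all_reals all_analysis.
From mathcomp Require Import ring.

Set Implicit Arguments.
Unset Strict Implicit.
Unset Printing Implicit Defensive.

Import Order.TTheory GRing.Theory Num.Theory.
Import numFieldNormedType.Exports.

Local Open Scope classical_set_scope.
Local Open Scope ring_scope.

(** * Linear algebra of vectors and covectors at a single point *)

Section PointwiseAlgebra.
Variables (F : fieldType) (n : nat).
Implicit Types (u v : 'I_n -> F) (a : 'M[F]_n).

Definition dot u v : F := \sum_i u i * v i.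

Lemma dotC u v : dot u v = dot v u.
Proof. by apply: eq_bigr => i _; rewrite mulrC. Qed.

Lemma dotDr u v w : dot u (fun i => v i + w i) = dot u v + dot u w.
Proof. by rewrite -big_split; apply: eq_bigr => i _; rewrite mulrDr. Qed.

Lemma dotZr u k v : dot u (fun i => k * v i) = k * dot u v.
Proof. by rewrite [RHS]mulr_sumr; apply: eq_bigr => i _; rewrite mulrCA. Qed.

Lemma dot_lin3 u (c1 c2 c3 : F) v1 v2 v3 :
  dot u (fun i => c1 * v1 i + c2 * v2 i + c3 * v3 i)
  = c1 * dot u v1 + c2 * dot u v2 + c3 * dot u v3.
Proof. by rewrite !dotDr !dotZr. Qed.

Lemma eq_dotr u v w : v =1 w -> dot u v = dot u w.
Proof. by move=> vw; apply: eq_bigr => i _; rewrite vw. Qed.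

(** Index lowering by [a]; applied with [invmx a] the same operation raises indices. *)
Definition lower a v : 'I_n -> F := fun i => dot (a i) v.

Lemma dot_lower a u v : (forall i j, a i j = a j i) ->
  dot u (lower a v) = dot (lower a u) v.
Proof.
move=> sym_a; rewrite /dot /lower /dot.
under eq_bigr => i _ do rewrite mulr_sumr.
rewrite exchange_big; apply: eq_bigr => j _.
rewrite mulr_suml; apply: eq_bigr => i _.
by rewrite mulrA (sym_a j i) [u i * _]mulrC.
Qed.

Lemma lower_invmx a v i : a \in unitmx -> lower a (lower (invmx a) v) i = v i.
Proof.
move=> unit_a; pose w : 'cV_n := \col_j v j.
suff E c u : lower c u = (c *m \col_j u j)^~ 0.
  transitivity ((a *m (invmx a *m w)) i 0).
    by rewrite E; congr (fun_of_matrix (_ *m _) _ _);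
      apply/colP => j; rewrite mxE E.
  by rewrite mulKVmx // mxE.
by apply/funext => j; rewrite mxE; apply: eq_bigr => k _; rewrite mxE.
Qed.

Lemma invmx_lower a v i : a \in unitmx -> lower (invmx a) (lower a v) i = v i.
Proof.
move=> unit_a; rewrite -unitmx_inv in unit_a.
by rewrite -[RHS](lower_invmx v i unit_a) invmxK.
Qed.

(** Invertibility reduces to a trivial kernel. The transpose enters because [kermx] is a left
    kernel, while [lower] multiplies by a column on the right. *)
Lemma unitmx_lower_inj a :
  (forall v, (forall i, lower a v i = 0) -> forall i, v i = 0) -> a \in unitmx.
Proof.
move=> inj_a; rewrite -unitmx_tr -row_free_unit -kermx_eq0.
apply/eqP/row_matrixP => k; rewrite row0; apply/rowP => i; rewrite [RHS]mxE.
apply: (inj_a (row k (kermx a^T) 0)) i => i.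
have : row k (kermx a^T) *m a^T = 0 by rewrite -row_mul mulmx_ker row0.
move/rowP/(_ i); rewrite [LHS]mxE [RHS]mxE => <-.
by apply: eq_bigr => j _; rewrite [a^T _ _]mxE mulrC.
Qed.

(** Matrices of the shape of the fundamental tensor of an (alpha, beta)-metric:
    [y] and [b] below are the covectors y_i = alpha_ij y^j and b_i. *)
Definition ab_tensor (p0 p1 p2 p3 : F) a (y b : 'I_n -> F) : 'M[F]_n :=
  \matrix_(i, j) (p0 * a i j + p1 * (y i * y j) + p2 * (y i * b j + b i * y j)
                  + p3 * (b i * b j)).

(** The rank-one terms see [v] only through its contractions with [y] and [b]. A linear system with
    this matrix is thus governed by two scalars once [a] is inverted. *)
Lemma lower_ab_tensor p0 p1 p2 p3 a y b v i :
  lower (ab_tensor p0 p1 p2 p3 a y b) v i =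
  p0 * lower a v i + (p1 * dot y v + p2 * dot b v) * y i
  + (p2 * dot y v + p3 * dot b v) * b i.
Proof.
transitivity (\sum_j (p0 * (a i j * v j) + p1 * y i * (y j * v j)
    + p2 * y i * (b j * v j) + p2 * b i * (y j * v j)
    + p3 * b i * (b j * v j))).
  by apply: eq_bigr => j _; rewrite mxE; ring.
by rewrite !big_split /= -!mulr_sumr /lower /dot; ring.
Qed.
End PointwiseAlgebra.

(** Both difference quotients are the same function of the increment. Directional derivatives
    thereby become derivatives in one real variable, where the chain rule for [Num.sqrt] and the
    rule for inverses apply. *)
Lemma is_derive_line (R : realType) (V : normedModType R) (f : V -> R)
    (x v : V) (df : R) :
  is_derive x v f df <->
  is_derive (0 : R) (1 : R) (fun t : R => f (t *: v + x)) df.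
Proof.
suff E : (fun h : R => h^-1 *: ((f \o shift x) (h *: v) - f x)) =
  (fun h : R => h^-1 *:
    (((fun t : R => f (t *: v + x)) \o shift 0) (h *: (1 : R))
     - f (0 *: v + x))).
  by split=> -[dfx vf]; split; move: dfx vf; rewrite /derivable /derive E.
by apply/funext => h /=; rewrite scale0r add0r addr0 [h *: (1 : R)]mulr1.
Qed.

(** * Calculus of F^2 as a function of alpha^2 and beta *)

Section SquaredGoldenMetric.
Variable R : realType.
Implicit Types A B : R.

(** The square of the golden metric as a function of [A] = alpha^2 and
    [B] = beta; the subscripts denote its partial derivatives. *)
Definition sqF A B : R :=
  (Num.sqrt A * ((B / Num.sqrt A) ^+ 2 - B / Num.sqrt A - 1)) ^+ 2.

Definition sqF_A A B : R :=
  let s := B / Num.sqrt A in - ((s ^+ 2 - s - 1) * (s ^+ 2 + 1)).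

Definition sqF_B A B : R :=
  let s := B / Num.sqrt A in
  2 * Num.sqrt A * ((s ^+ 2 - s - 1) * (2 * s - 1)).

Definition sqF_AA A B : R :=
  let s := B / Num.sqrt A in
  - (s * (1 + 3 * s ^+ 2 - 4 * s ^+ 3) / (2 * Num.sqrt A ^+ 2)).

Definition sqF_AB A B : R :=
  let s := B / Num.sqrt A in (1 + 3 * s ^+ 2 - 4 * s ^+ 3) / Num.sqrt A.

Definition sqF_BB A B : R :=
  let s := B / Num.sqrt A in 2 * (6 * s ^+ 2 - 6 * s - 1).

Lemma is_derive_sqrt_ratio (V : normedModType R) (f g : V -> R) (x v : V)
    (df dg : R) : 0 < f x -> is_derive x v f df -> is_derive x v g dg ->
  is_derive x v (fun u => Num.sqrt (f u)) (df / (2 * Num.sqrt (f x))) /\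
  is_derive x v (fun u => g u / Num.sqrt (f u))
    (dg / Num.sqrt (f x)
     - g x / Num.sqrt (f x) * df / (2 * Num.sqrt (f x) ^+ 2)).
Proof.
move=> fx0 /is_derive_line Df /is_derive_line Dg.
have fx0' : 0 < f (0 *: v + x) by rewrite scale0r add0r.
have al0 : 0 < Num.sqrt (f x) by rewrite sqrtr_gt0.
have al0' : Num.sqrt (f (0 *: v + x)) != 0 by rewrite scale0r add0r gt_eqF.
have Dal : is_derive (0 : R) (1 : R) (fun t : R => Num.sqrt (f (t *: v + x)))
    (df / (2 * Num.sqrt (f x))).
  apply: is_derive_eq; first exact: (is_derive1_comp (f := Num.sqrt)
    (g := fun t : R => f (t *: v + x)) (is_derive1_sqrt fx0') Df).
  by rewrite scale0r add0r mulrC.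
split; first exact/is_derive_line.
have Dinv := is_deriveV (f := fun t : R => Num.sqrt (f (t *: v + x))) al0' Dal.
have Dq := is_deriveM Dg Dinv.
apply/is_derive_line; apply: (is_derive_eq Dq).
rewrite !scale0r !add0r /GRing.scale /=.
by field; rewrite gt_eqF.
Qed.

(** With phi = s^2 - s - 1, F^2 = A phi^2 has A-derivative phi (phi - s phi'), and phi - s phi' =
    -(s^2 + 1). Keeping [f] and [g] arbitrary lets one chain rule serve both the derivatives in y
    and those in x. *)
Lemma is_derive_sqF (V : normedModType R) (f g : V -> R) (x v : V)
    (df dg : R) : 0 < f x -> is_derive x v f df -> is_derive x v g dg ->
  is_derive x v (fun u => sqF (f u) (g u))
    (sqF_A (f x) (g x) * df + sqF_B (f x) (g x) * dg).
Proof.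
move=> fx0 Df Dg.
have al0 : Num.sqrt (f x) != 0 by rewrite gt_eqF // sqrtr_gt0.
have [Dal Ds] := is_derive_sqrt_ratio fx0 Df Dg.
rewrite /sqF /sqF_A /sqF_B.
apply: is_derive_eq; rewrite /GRing.scale /=.
by field.
Qed.

Lemma is_derive_sqF_A (V : normedModType R) (f g : V -> R) (x v : V)
    (df dg : R) : 0 < f x -> is_derive x v f df -> is_derive x v g dg ->
  is_derive x v (fun u => sqF_A (f u) (g u))
    (sqF_AA (f x) (g x) * df + sqF_AB (f x) (g x) * dg).
Proof.
move=> fx0 Df Dg.
have al0 : Num.sqrt (f x) != 0 by rewrite gt_eqF // sqrtr_gt0.
have [Dal Ds] := is_derive_sqrt_ratio fx0 Df Dg.
rewrite /sqF_A /sqF_AA /sqF_AB.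
apply: is_derive_eq; rewrite /GRing.scale /=.
by field.
Qed.

(** The mixed coefficient [sqF_AB] is the one already met when differentiating [sqF_A], which later
    makes the fundamental tensor symmetric in Y and b. *)
Lemma is_derive_sqF_B (V : normedModType R) (f g : V -> R) (x v : V)
    (df dg : R) : 0 < f x -> is_derive x v f df -> is_derive x v g dg ->
  is_derive x v (fun u => sqF_B (f u) (g u))
    (sqF_AB (f x) (g x) * df + sqF_BB (f x) (g x) * dg).
Proof.
move=> fx0 Df Dg.
have al0 : Num.sqrt (f x) != 0 by rewrite gt_eqF // sqrtr_gt0.
have [Dal Ds] := is_derive_sqrt_ratio fx0 Df Dg.
rewrite /sqF_B /sqF_AB /sqF_BB.
apply: is_derive_eq; rewrite /GRing.scale /=.
by field.
Qed.
End SquaredGoldenMetric.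

(** * Derivatives of contractions, along the fibre and along the base *)

Lemma is_derive_dot (R : realType) (n : nat) (V : normedModType R)
    (f g : V -> 'I_n -> R) (x v : V) (df dg : 'I_n -> R) :
  (forall i, is_derive x v (f^~ i) (df i)) ->
  (forall i, is_derive x v (g^~ i) (dg i)) ->
  is_derive x v (fun u => dot (f u) (g u)) (dot df (g x) + dot (f x) dg).
Proof.
move=> Df Dg.
(* As a sum of products of functions, the contraction gets its derivative by inference from the sum
   and product rules. *)
have -> : (fun u => dot (f u) (g u)) = \sum_i (f^~ i * g^~ i).
  by apply/funext => u; rewrite fct_sumE.
apply: is_derive_eq; rewrite -big_split; apply: eq_bigr => i _ /=.
by rewrite addrC [_ *: df i]mulrC.
Qed.

Lemma is_derive_coord (R : realType) (n : nat) (i : 'I_n) (y v : 'rV[R]_n) :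
  is_derive y v (fun w : 'rV[R]_n => w 0 i) (v 0 i).
Proof.
apply/is_derive_line.
have -> : (fun t : R => (t *: v + y) 0 i) = (fun t => t * v 0 i + y 0 i).
  by apply/funext => t; rewrite !mxE.
by apply: is_derive_eq; rewrite /GRing.scale /=; ring.
Qed.

Lemma dot_delta (R : realType) (n : nat) (l : 'I_n) (u : 'I_n -> R) :
  dot u ((delta_mx 0 l : 'rV[R]_n) 0) = u l.
Proof.
rewrite /dot (bigD1 l) //= big1 ?mxE ?eqxx ?mulr1 ?addr0 // => i /negPf il.
by rewrite mxE il andbF mulr0.
Qed.

Definition quad (R : realType) (n : nat) (m : 'M[R]_n) (y : 'rV[R]_n) : R :=
  dot (y 0) (lower m (y 0)).

Lemma quadE (R : realType) (n : nat) (m : 'M[R]_n) (y : 'rV[R]_n) :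
  quad m y = \sum_i \sum_j m i j * y 0 i * y 0 j.
Proof.
apply: eq_bigr => i _; rewrite [LHS]mulr_sumr.
by apply: eq_bigr => j _; rewrite mulrA [y 0 i * _]mulrC.
Qed.

(** On a kernel vector the quadratic form vanishes, which positivity permits only at 0. *)
Lemma posdef_unitmx (R : realType) (n : nat) (m : 'M[R]_n) :
  (forall v : 'rV[R]_n, v != 0 -> 0 < quad m v) -> m \in unitmx.
Proof.
move=> pos; apply: unitmx_lower_inj => v mv0 i.
pose w : 'rV[R]_n := \row_j v j.
have wE : w 0 = v by apply/funext => j; rewrite mxE.
have [/rowP/(_ i)|/pos] := eqVneq w 0; first by rewrite !mxE.
by rewrite /quad wE [dot _ _]big1 ?ltxx // => j _; rewrite mv0 mulr0.
Qed.

Section Directions.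
Variables (R : realType) (n : nat).
Implicit Types (x y : 'rV[R]_n) (m : 'M[R]_n).

Lemma is_derive_dot_fiber (c : 'I_n -> R) y l :
  is_derive y (delta_mx 0 l) (fun v : 'rV[R]_n => dot c (v 0)) (c l).
Proof.
have D := @is_derive_dot R n _ (fun=> c) (fun v : 'rV[R]_n => v 0) y
  (delta_mx 0 l) _ _ (fun i => is_derive_cst _ _ _)
  (fun i => is_derive_coord i y (delta_mx 0 l)).
apply: (is_derive_eq D); rewrite dot_delta [X in X + _]big1 ?add0r //.
by move=> i _; rewrite mul0r.
Qed.

(** The product rule gives one term with [m] and one with its transpose; symmetry merges them into
    the factor 2. *)
Lemma is_derive_quad_fiber m y l : (forall i j, m i j = m j i) ->
  is_derive y (delta_mx 0 l) (quad m) (2 * lower m (y 0) l).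
Proof.
move=> sym_m.
have D := @is_derive_dot R n _ (fun v : 'rV[R]_n => v 0)
  (fun v => lower m (v 0)) y (delta_mx 0 l) _ _
  (fun i => is_derive_coord i y (delta_mx 0 l))
  (fun i => is_derive_dot_fiber (m i) y l).
apply: (is_derive_eq D); rewrite dotC dot_delta mulr2n mulrDl mul1r.
congr (_ + _).
by rewrite dotC; apply: eq_bigr => i _; rewrite sym_m.
Qed.

Variables (a : 'rV[R]_n -> 'M[R]_n) (b : 'rV[R]_n -> 'rV[R]_n).
Variable (x : 'rV[R]_n).

(** Kept as one matrix per direction [k], so that [lower] and [quad] apply to the derivatives of the
    metric. *)
Definition metric_partial (k : 'I_n) : 'M[R]_n :=
  \matrix_(i, j) partial k (fun u => a u i j) x.

Definition form_partial (k i : 'I_n) : R := partial k (fun u => b u 0 i) x.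

Hypothesis a_derivable : forall i j k : 'I_n,
  derivable (fun u => a u i j) x (delta_mx 0 k).
Hypothesis b_derivable : forall i k : 'I_n,
  derivable (fun u => b u 0 i) x (delta_mx 0 k).

Lemma is_derive_lower_base y k l :
  is_derive x (delta_mx 0 k) (fun u => lower (a u) (y 0) l)
    (lower (metric_partial k) (y 0) l).
Proof.
have D := @is_derive_dot R n _ (fun u => a u l) (fun=> y 0) x (delta_mx 0 k)
  _ _ (fun i => derivableP (@a_derivable l i k)) (fun i => is_derive_cst _ _ _).
apply: (is_derive_eq D); rewrite [X in _ + X]big1 ?addr0.
  by apply: eq_bigr => i _; rewrite mxE.
by move=> i _; rewrite mulr0.
Qed.

Lemma is_derive_quad_base y k :
  is_derive x (delta_mx 0 k) (fun u => quad (a u) y)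
    (quad (metric_partial k) y).
Proof.
have D := @is_derive_dot R n _ (fun=> y 0) (fun u => lower (a u) (y 0))
  x (delta_mx 0 k) _ _ (fun i => is_derive_cst _ _ _)
  (fun i => is_derive_lower_base y k i).
apply: (is_derive_eq D); rewrite [X in X + _]big1 ?add0r //.
by move=> i _; rewrite mul0r.
Qed.

Lemma is_derive_beta_base y k :
  is_derive x (delta_mx 0 k) (fun u => beta_eval b u y)
    (dot (form_partial k) (y 0)).
Proof.
have D := @is_derive_dot R n _ (fun u => b u 0) (fun=> y 0) x (delta_mx 0 k)
  _ _ (fun i => derivableP (@b_derivable i k)) (fun i => is_derive_cst _ _ _).
apply: (is_derive_eq D); rewrite [X in _ + X]big1 ?addr0 //.
by move=> i _; rewrite mulr0.
Qed.
End Directions.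

(** * The spray as the solution of a linear system *)

Section SprayRhs.
Variables (R : realType) (n : nat) (F : 'rV[R]_n -> 'rV[R]_n -> R).
Variables (x y : 'rV[R]_n).

Definition euler_lagrange (l : 'I_n) : R :=
  \sum_k partial k (fun u => partial l (fun v => F u v ^+ 2) y) x * y 0 k
  - partial l (fun u => F u y ^+ 2) x.

Lemma sprayE i : spray F x y i =
  lower (invmx (fundamental_tensor F x y)) (fun l => 4^-1 * euler_lagrange l) i.
Proof. by rewrite [RHS]dotZr. Qed.

Lemma lower_spray l : fundamental_tensor F x y \in unitmx ->
  lower (fundamental_tensor F x y) (spray F x y) l = 4^-1 * euler_lagrange l.
Proof.
move=> g_unit; have /funext -> := sprayE.
exact: lower_invmx.
Qed.

(** A candidate is checked after lowering its index, so the inverse of the fundamental tensor never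
    has to be computed. *)
Lemma spray_unique (H : 'I_n -> R) i : fundamental_tensor F x y \in unitmx ->
  (forall l, lower (fundamental_tensor F x y) H l = 4^-1 * euler_lagrange l) ->
  spray F x y i = H i.
Proof.
move=> g_unit HE; rewrite sprayE -(invmx_lower H i g_unit).
by apply: eq_dotr => l; rewrite HE.
Qed.
End SprayRhs.

(** * Local coordinates: fundamental tensor and spray of alpha *)

Section LocalSpray.
Variables (R : realType) (n : nat).
Variables (a : 'rV[R]_n -> 'M[R]_n) (b : 'rV[R]_n -> 'rV[R]_n).
Variables (U : set 'rV[R]_n) (x y : 'rV[R]_n).
Hypothesis U_open : open U.
Hypothesis Ux : U x.
Hypothesis y_neq0 : y != 0.
Hypothesis a_sym : forall u, U u -> forall i j, a u i j = a u j i.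
Hypothesis a_posdef : forall u, U u -> forall v, v != 0 -> 0 < quad (a u) v.
Hypothesis a_derivable : forall i j k : 'I_n,
  derivable (fun u => a u i j) x (delta_mx 0 k).
Hypothesis b_derivable : forall i k : 'I_n,
  derivable (fun u => b u 0 i) x (delta_mx 0 k).

Let Da k : 'M[R]_n := metric_partial a x k.
Let Db k : 'I_n -> R := form_partial b x k.

Lemma near_domain : \forall u \near x, U u.
Proof. by apply: open_nbhs_nbhs; split. Qed.

(** The chain rule for [sqF] requires alpha^2 > 0, so first fibre derivatives of F^2 are obtained
    off the zero section only; this neighbourhood allows differentiating them again at [y]. *)
Lemma near_neq0 : \forall v \near y, v != 0.
Proof.
have : nbhs y (~` [set 0]).
  apply: open_nbhs_nbhs; split; last exact/eqP.
  apply: closed_openC; apply: accessible_closed_set1.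
  exact: hausdorff_accessible (@norm_hausdorff _ _).
by apply: filterS => v /eqP.
Qed.

Lemma partialE (f : 'rV[R]_n -> R) z l df :
  is_derive z (delta_mx 0 l) f df -> partial l f z = df.
Proof. by move=> [_ <-]. Qed.

(** A derivative depends only on the germ, whereas symmetry and positivity of [a u] are known only
    for [u] in [U]. *)
Lemma partial_near (f g : 'rV[R]_n -> R) z l df :
  (\forall u \near z, g u = f u) ->
  is_derive z (delta_mx 0 l) f df -> partial l g z = df.
Proof. by move=> fg [_ <-]; exact: near_eq_derive. Qed.

Lemma alpha_normE u v : alpha_norm a u v = Num.sqrt (quad (a u) v).
Proof. by rewrite quadE. Qed.

Lemma alpha_norm_sq u v : U u -> alpha_norm a u v ^+ 2 = quad (a u) v.
Proof.
move=> Uu; rewrite alpha_normE sqr_sqrtr //.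
(* The zero vector is treated apart, so that the identity holds on the whole fibre and can be used
   under a fibre derivative without a neighbourhood. *)
have [->|/(a_posdef Uu)/ltW //] := eqVneq v 0.
by rewrite /quad [dot _ _]big1 // => i _; rewrite mxE mul0r.
Qed.

Lemma partial_alpha_norm_sq u v l : U u ->
  partial l (fun v => alpha_norm a u v ^+ 2) v = 2 * lower (a u) (v 0) l.
Proof.
move=> Uu; have -> : (fun v => alpha_norm a u v ^+ 2) = quad (a u).
  by apply/funext => w; exact: alpha_norm_sq.
exact/partialE/is_derive_quad_fiber/a_sym.
Qed.

Lemma fundamental_tensor_alpha : fundamental_tensor (alpha_norm a) x y = a x.
Proof.
apply/matrixP => i j; rewrite mxE.
rewrite (_ : partial j _ = fun v => 2 * lower (a x) (v 0) j); last first.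
  by apply/funext => v; exact: partial_alpha_norm_sq.
have D := is_deriveZ 2 (is_derive_dot_fiber (a x j) y i).
by rewrite (partialE D) mulKf // (a_sym Ux).
Qed.

Lemma euler_lagrange_alpha l : euler_lagrange (alpha_norm a) x y l =
  \sum_k 2 * lower (Da k) (y 0) l * y 0 k - quad (Da l) y.
Proof.
congr (_ - _).
  apply: eq_bigr => k _; congr (_ * _).
  apply: (@partial_near (fun u => 2 * lower (a u) (y 0) l)).
    by near=> u; apply: partial_alpha_norm_sq; near: u; exact: near_domain.
  exact: (is_deriveZ 2 (is_derive_lower_base (@a_derivable) y k l)).
apply: (@partial_near (fun u => quad (a u) y)).
  by near=> u; apply: alpha_norm_sq; near: u; exact: near_domain.
exact: is_derive_quad_base.
Unshelve. all: by end_near. Qed.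

Lemma a_unit : a x \in unitmx.
Proof. exact/posdef_unitmx/a_posdef. Qed.

(** The right-hand side is half the Christoffel symbol of the first kind, contracted twice with
    y. *)
Lemma lower_spray_alpha l : lower (a x) (spray (alpha_norm a) x y) l =
  4^-1 * (\sum_k 2 * lower (Da k) (y 0) l * y 0 k - quad (Da l) y).
Proof.
by rewrite -euler_lagrange_alpha -lower_spray fundamental_tensor_alpha ?a_unit.
Qed.

(** * Fundamental tensor and Euler-Lagrange expression of the golden metric *)

Let A := quad (a x) y.
Let B := beta_eval b x y.

Lemma golden_metric_sq u v :
  golden_metric a b u v ^+ 2 = sqF (quad (a u) v) (beta_eval b u v).
Proof. by rewrite /golden_metric /ab_ratio alpha_normE. Qed.

Lemma partial_golden_sq u v l : U u -> v != 0 ->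
  partial l (fun v => golden_metric a b u v ^+ 2) v =
  sqF_A (quad (a u) v) (beta_eval b u v) * (2 * lower (a u) (v 0) l)
  + sqF_B (quad (a u) v) (beta_eval b u v) * b u 0 l.
Proof.
move=> Uu v0.
rewrite (_ : (fun v => _) = fun v => sqF (quad (a u) v) (beta_eval b u v)).
  apply/partialE/is_derive_sqF; first exact: a_posdef.
    exact/is_derive_quad_fiber/a_sym.
  exact: is_derive_dot_fiber.
by apply/funext => w; exact: golden_metric_sq.
Qed.

(** This is half the fibre derivative of P_A 2 Y_j + P_B b_j. The fibre gradients of alpha^2 and
    beta are 2 Y and b, so P_AA acquires the factor 2 * 2 / 2, P_AB the factor 1 and P_BB the factor
    1/2. *)
Lemma fundamental_tensor_golden : fundamental_tensor (golden_metric a b) x y =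
  ab_tensor (sqF_A A B) (2 * sqF_AA A B) (sqF_AB A B) (2^-1 * sqF_BB A B)
    (a x) (lower (a x) (y 0)) (b x 0).
Proof.
have A_gt0 := a_posdef Ux y_neq0.
have DA i := is_derive_quad_fiber y i (a_sym Ux).
have DB i : is_derive y (delta_mx 0 i) (beta_eval b x) (b x 0 i).
  exact: is_derive_dot_fiber.
apply/matrixP => i j; rewrite !mxE.
have D := is_deriveD
  (is_deriveM (is_derive_sqF_A A_gt0 (DA i) (DB i))
     (is_deriveZ 2 (is_derive_dot_fiber (a x j) y i)))
  (is_deriveM (is_derive_sqF_B A_gt0 (DA i) (DB i))
     (is_derive_cst (b x 0 j) _ _)).
rewrite (partial_near _ D).
  rewrite /= /GRing.scale /= /cst -/A -/B -/(lower _ _ j) (a_sym Ux j i).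
  by field.
by near=> v; apply: partial_golden_sq => //; near: v; exact: near_neq0.
Unshelve. all: by end_near. Qed.

(** The summand is the product rule in direction [k] for P_A 2 Y_l + P_B b_l, with Y, b, P_A and P_B
    all depending on the base point. *)
Lemma euler_lagrange_golden l : euler_lagrange (golden_metric a b) x y l =
  \sum_k ((sqF_AA A B * quad (Da k) y + sqF_AB A B * dot (Db k) (y 0))
            * (2 * lower (a x) (y 0) l)
          + sqF_A A B * (2 * lower (Da k) (y 0) l)
          + (sqF_AB A B * quad (Da k) y + sqF_BB A B * dot (Db k) (y 0))
            * b x 0 l
          + sqF_B A B * Db k l) * y 0 k
  - (sqF_A A B * quad (Da l) y + sqF_B A B * dot (Db l) (y 0)).
Proof.
have A_gt0 := a_posdef Ux y_neq0.
have DA := is_derive_quad_base (@a_derivable) y.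
have DB := is_derive_beta_base (@b_derivable) y.
congr (_ - _).
  apply: eq_bigr => k _; congr (_ * _).
  have D := is_deriveD
    (is_deriveM
       (is_derive_sqF_A (f := fun u => quad (a u) y) A_gt0 (DA k) (DB k))
       (is_deriveZ 2 (is_derive_lower_base (@a_derivable) y k l)))
    (is_deriveM
       (is_derive_sqF_B (f := fun u => quad (a u) y) A_gt0 (DA k) (DB k))
       (derivableP (@b_derivable l k))).
  rewrite (partial_near _ D).
    by rewrite /= /GRing.scale /= -/A -/B /Db /form_partial /partial; ring.
  by near=> u; apply: partial_golden_sq => //; near: u; exact: near_domain.
have D := is_derive_sqF (f := fun u => quad (a u) y) A_gt0 (DA l) (DB l).
by rewrite (partial_near _ D) //; near=> u; exact: golden_metric_sq.
Unshelve. all: by end_near. Qed.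

(** * Christoffel symbols, and derivatives of alpha^2 and beta along the spray *)

Lemma metric_partial_sym k i j : Da k i j = Da k j i.
Proof.
rewrite !mxE; apply: near_eq_derive.
by near=> u; apply: a_sym; near: u; exact: near_domain.
Unshelve. all: by end_near. Qed.

Lemma christoffelE k i j : christoffel a x k i j =
  lower (invmx (a x)) (fun l => 2^-1 * (Da i j l + Da j i l - Da l i j)) k.
Proof.
rewrite [RHS]dotZr; congr (_ * _).
by apply: eq_bigr => l _; rewrite !mxE.
Qed.

Lemma christoffel_sym k i j : christoffel a x k i j = christoffel a x k j i.
Proof.
rewrite !christoffelE; apply: eq_dotr => l.
by rewrite (metric_partial_sym l i j) [Da i j l + _]addrC.
Qed.

Let Gal := spray (alpha_norm a) x y.
Let Y := lower (a x) (y 0).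

(** Expresses that alpha^2 is constant along the geodesics of alpha. Contracting the lowered spray
    equation with y yields the sum on the left twice from the first term and minus once from the
    second. *)
Lemma sum_quad_metric_partial :
  \sum_k quad (Da k) y * y 0 k = 4 * dot Y Gal.
Proof.
have ax_sym := a_sym Ux.
rewrite -dot_lower // -dotZr.
have E l : 4 * lower (a x) Gal l =
    \sum_k 2 * lower (Da k) (y 0) l * y 0 k - quad (Da l) y.
  by rewrite lower_spray_alpha mulVKf.
rewrite (eq_dotr _ E) dotDr.
rewrite [X in _ + X](_ : _ = - \sum_k quad (Da k) y * y 0 k); last first.
  by rewrite -sumrN; apply: eq_bigr => k _; rewrite mulrN mulrC.
rewrite [X in X - _](_ : _ = 2 * \sum_k quad (Da k) y * y 0 k); first by ring.
rewrite mulr_sumr /dot; under eq_bigr => l _ do rewrite mulr_sumr.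
rewrite exchange_big; apply: eq_bigr => k _; rewrite /quad {1}/dot.
by rewrite mulr_suml mulr_sumr; apply: eq_bigr => l _; ring.
Qed.

(** Ties the covariant derivative, built from Christoffel symbols, to the spray of alpha, built from
    the Finsler formula. Contraction with y makes the first two metric derivatives equal. *)
Lemma christoffel_00 k :
  \sum_i \sum_j christoffel a x k i j * y 0 i * y 0 j = 2 * Gal k.
Proof.
rewrite /Gal sprayE fundamental_tensor_alpha -dotZr.
transitivity (dot (invmx (a x) k) (fun l => \sum_i \sum_j
    2^-1 * (Da i j l + Da j i l - Da l i j) * y 0 i * y 0 j)).
  rewrite /dot; under [RHS]eq_bigr => l _ do rewrite mulr_sumr.
  rewrite [RHS]exchange_big; apply: eq_bigr => i _ /=.
  under [RHS]eq_bigr => l _ do rewrite mulr_sumr.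
  rewrite [RHS]exchange_big; apply: eq_bigr => j _ /=.
  rewrite christoffelE /lower /dot !mulr_suml.
  by apply: eq_bigr => l _; rewrite !mulrA.
apply: eq_dotr => l; rewrite euler_lagrange_alpha quadE.
have swap : \sum_i \sum_j Da i j l * y 0 i * y 0 j =
            \sum_i \sum_j Da j i l * y 0 i * y 0 j.
  rewrite exchange_big; apply: eq_bigr => i _; apply: eq_bigr => j _ /=.
  by rewrite -!mulrA [y 0 i * _]mulrC.
have lowE : \sum_k0 2 * lower (Da k0) (y 0) l * y 0 k0 =
            2 * \sum_i \sum_j Da i j l * y 0 i * y 0 j.
  rewrite mulr_sumr; apply: eq_bigr => i _.
  rewrite /lower /dot mulr_sumr mulr_suml mulr_sumr; apply: eq_bigr => j _.
  by rewrite (metric_partial_sym i l j); ring.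
rewrite lowE; set W := \sum_i \sum_j Da l i j * _ * _.
set X := \sum_i \sum_j Da i j l * _ * _.
transitivity (2^-1 * (X + X - W)); last by field.
rewrite {2}/X swap -big_split -sumrB mulr_sumr /=.
apply: eq_bigr => i _; rewrite -big_split -sumrB mulr_sumr /=.
by apply: eq_bigr => j _; ring.
Qed.

(** Only the symmetric part of b_{i|j} survives contraction with y twice, and by [christoffel_00]
    its Christoffel term contributes 2 b.G. Thus [r_00] is the derivative of beta along the
    geodesics of alpha. *)
Lemma sum_form_partial : \sum_k dot (Db k) (y 0) * y 0 k =
  r_00 a b x y + 2 * dot (b x 0) Gal.
Proof.
have -> : r_00 a b x y = \sum_i \sum_j b_cov a b x i j * y 0 i * y 0 j.
  pose C := \sum_i \sum_j b_cov a b x i j * y 0 i * y 0 j.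
  transitivity (2^-1 * (C + C)); last by rewrite -/C; field.
  rewrite {2}/C exchange_big /C -big_split mulr_sumr; apply: eq_bigr => i _ /=.
  rewrite -big_split mulr_sumr; apply: eq_bigr => j _ /=.
  by rewrite /r_dd; ring.
have -> : 2 * dot (b x 0) Gal =
    \sum_i \sum_j (\sum_k christoffel a x k i j * b x 0 k) * y 0 i * y 0 j.
  rewrite -dotZr.
  under eq_dotr => k do rewrite -christoffel_00.
  rewrite /dot; under eq_bigr => k _ do rewrite mulr_sumr.
  rewrite exchange_big; apply: eq_bigr => i _ /=.
  under eq_bigr => k _ do rewrite mulr_sumr.
  rewrite exchange_big; apply: eq_bigr => j _ /=.
  by rewrite !mulr_suml; apply: eq_bigr => k _; ring.
rewrite -big_split /dot /=; under eq_bigr => k _ do rewrite mulr_suml.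
rewrite exchange_big /=; apply: eq_bigr => i _ /=; rewrite -big_split.
by apply: eq_bigr => j _ /=; rewrite /b_cov /Db /form_partial; ring.
Qed.

(** * The skew part of the covariant derivative, and the contractions with Y and b *)

Let S l := dot (s_dd a b x l) (y 0).

(** The Christoffel symbols are symmetric in their lower indices, so they cancel from the skew part,
    leaving the exterior derivative of beta. *)
Lemma form_curl l : \sum_k Db k l * y 0 k - dot (Db l) (y 0) = 2 * S l.
Proof.
rewrite -sumrB mulr_sumr; apply: eq_bigr => k _.
rewrite /s_dd /b_cov (eq_bigr (fun m => christoffel a x m k l * b x 0 m)).
  by rewrite /Db /form_partial; field.
by move=> m _; rewrite christoffel_sym.
Qed.

Lemma s_u0E i : s_u0 a b x y i = lower (invmx (a x)) S i.
Proof.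
rewrite /s_u0 /s_ud /lower /S /dot; under eq_bigr => j _ do rewrite mulr_suml.
rewrite exchange_big; apply: eq_bigr => h _ /=; rewrite mulr_sumr.
by apply: eq_bigr => j _; rewrite mulrA.
Qed.

Lemma lower_s_u0 l : lower (a x) (s_u0 a b x y) l = S l.
Proof.
by have /funext -> := s_u0E; rewrite lower_invmx // a_unit.
Qed.

Lemma lower_b_up l : lower (a x) (b_up a b x) l = b x 0 l.
Proof. by rewrite (lower_invmx _ _ a_unit). Qed.

(** Moving the lowering across turns this into s_00, which skew-symmetry makes its own negative. *)
Lemma dot_Y_s_u0 : dot Y (s_u0 a b x y) = 0.
Proof.
rewrite -(dot_lower _ _ (a_sym Ux)) (eq_dotr _ lower_s_u0).
have : dot (y 0) S = - dot (y 0) S.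
  rewrite {1}/dot /S /dot; under eq_bigr => i _ do rewrite mulr_sumr.
  rewrite [LHS]exchange_big -sumrN; apply: eq_bigr => j _ /=.
  rewrite -sumrN; apply: eq_bigr => i _.
  by rewrite /s_dd; ring.
by move/eqP; rewrite -addr_eq0 -mulr2n mulrn_eq0 /= => /eqP.
Qed.

Lemma dot_b_s_u0 : dot (b x 0) (s_u0 a b x y) = s_0 a b x y.
Proof.
have /funext <- := lower_b_up.
rewrite -(dot_lower _ _ (a_sym Ux)) (eq_dotr _ lower_s_u0).
rewrite /s_0 /s_d /S /dot.
under eq_bigr => i _ do rewrite mulr_sumr.
rewrite exchange_big; apply: eq_bigr => j _ /=; rewrite mulr_suml.
by apply: eq_bigr => i _; rewrite mulrA.
Qed.

Lemma dot_Y_b_up : dot Y (b_up a b x) = B.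
Proof. by rewrite -(dot_lower _ _ (a_sym Ux)) (eq_dotr _ lower_b_up) dotC. Qed.

Lemma dot_b_b_up : dot (b x 0) (b_up a b x) = b_sq a b x.
Proof. exact: quadE. Qed.

Lemma dot_Y_y : dot Y (y 0) = A.
Proof. by rewrite dotC. Qed.

Lemma dot_b_y : dot (b x 0) (y 0) = B.
Proof. by []. Qed.

(** * Nondegeneracy of the fundamental tensor and the spray formula *)

Let al := alpha_norm a x y.
Let s := ab_ratio a b x y.
Let b2 := b_sq a b x.

Hypothesis phi_neq0 : s ^+ 2 - s - 1 != 0.
Hypothesis z_neq0 : golden_z b2 s != 0.

Lemma al_gt0 : 0 < al.
Proof. by rewrite /al alpha_normE sqrtr_gt0 a_posdef. Qed.

Lemma beta_ratio : B = s * al.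
Proof. by rewrite /s /ab_ratio divfK // gt_eqF // al_gt0. Qed.

Lemma sqrs1_neq0 : s ^+ 2 + 1 != 0.
Proof. by rewrite gt_eqF // ltr_wpDl ?sqr_ge0. Qed.

Lemma fundamental_tensor_golden_unit :
  fundamental_tensor (golden_metric a b) x y \in unitmx.
Proof.
have al0 : al != 0 by rewrite gt_eqF // al_gt0.
have ax_sym := a_sym Ux.
have AE : A = al ^+ 2 by rewrite alpha_norm_sq.
have sE : B / Num.sqrt A = s by rewrite /A -alpha_normE.
have alE : Num.sqrt A = al by rewrite -alpha_normE.
apply: unitmx_lower_inj => v; rewrite fundamental_tensor_golden.
pose p := dot Y v; pose q := dot (b x 0) v; pose w := lower (a x) v.
pose k := 1 + 3 * s ^+ 2 - 4 * s ^+ 3.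
pose phi := s ^+ 2 - s - 1.
have gE l : lower (ab_tensor (sqF_A A B) (2 * sqF_AA A B) (sqF_AB A B)
      (2^-1 * sqF_BB A B) (a x) Y (b x 0)) v l
    = - (phi * (s ^+ 2 + 1)) * w l
      + (- (s * k / al ^+ 2) * p + k / al * q) * Y l
      + (k / al * p + (6 * s ^+ 2 - 6 * s - 1) * q) * b x 0 l.
  rewrite lower_ab_tensor -/p -/q -/w /sqF_A /sqF_AA /sqF_AB /sqF_BB sE alE.
  by rewrite -/k -/phi; field.
move=> gv0.
have contract u : - (phi * (s ^+ 2 + 1)) * dot u w
      + (- (s * k / al ^+ 2) * p + k / al * q) * dot u Y
      + (k / al * p + (6 * s ^+ 2 - 6 * s - 1) * q) * dot u (b x 0) = 0.
  rewrite -dot_lin3 [LHS]big1 // => l _.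
  by rewrite -gE gv0 mulr0.
have qE : dot (lower (a x) (b_up a b x)) v = q.
  by apply: eq_bigr => l _; rewrite lower_b_up.
have E1 := contract (y 0); have E2 := contract (b_up a b x).
rewrite [dot _ w]dot_lower // [dot _ Y]dotC dot_Y_y [dot _ (b x 0)]dotC dot_b_y
  -/p AE beta_ratio in E1.
rewrite [dot _ w]dot_lower // [dot _ Y]dotC dot_Y_b_up [dot _ (b x 0)]dotC
  dot_b_b_up qE beta_ratio -/b2 in E2.
(* In [E1] the terms in [k * p] cancel and the rest is divisible by phi: by homogeneity, contracting
   g with y gives half the fibre differential of F^2. *)
have pq : (s ^+ 2 + 1) * p = al * (2 * s - 1) * q.
  apply: (mulfI phi_neq0); apply/eqP; rewrite -subr_eq0 -oppr_eq0; apply/eqP.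
  by rewrite -E1 /k /phi; field.
have q0 : q = 0.
  (* Eliminating [p] from [E2] and multiplying by -(s^2 + 1) produces exactly this product. *)
  have : phi ^+ 2 * golden_z b2 s * q = 0.
    rewrite -[RHS](mulr0 (- (s ^+ 2 + 1))) -E2 /k /phi /golden_z.
    have -> : p = al * (2 * s - 1) * q / (s ^+ 2 + 1).
      by rewrite -pq [_ * p]mulrC mulfK // sqrs1_neq0.
    by field; rewrite al0 sqrs1_neq0.
  move/eqP; rewrite mulf_eq0 mulf_eq0 sqrf_eq0.
  by rewrite (negPf phi_neq0) (negPf z_neq0) => /eqP.
have p0 : p = 0.
  by apply: (mulfI sqrs1_neq0); rewrite pq q0 !mulr0.
(* With both contractions zero, g v is -phi (s^2 + 1) times [w]; hence [w] vanishes, and [v] is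
   recovered from it by raising the index. *)
move=> i; rewrite -(invmx_lower v i a_unit) -/w [LHS]big1 // => l _.
have := gE l; rewrite gv0 p0 q0 !mulr0 !addr0 !mul0r !addr0.
move=> /esym/eqP; rewrite mulf_eq0 oppr_eq0 mulf_eq0 (negPf phi_neq0).
by rewrite (negPf sqrs1_neq0) => /eqP ->; rewrite mulr0.
Qed.

(** The factor Q is fixed by al Q P_A = P_B / 2, which matches the terms in s_{l0}; Psi and Theta
    then balance the coefficients of b_l and Y_l. *)
Lemma golden_spray i : spray (golden_metric a b) x y i =
  Gal i + al * golden_Q s * s_u0 a b x y i
  + (- 2 * al * golden_Q s * s_0 a b x y + r_00 a b x y)
    * (golden_Psi b2 s * b_up a b x i + golden_Theta b2 s * al^-1 * y 0 i).
Proof.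
have al0 : al != 0 by rewrite gt_eqF // al_gt0.
have AE : A = al ^+ 2 by rewrite alpha_norm_sq.
have sE : B / Num.sqrt A = s by rewrite /A -alpha_normE.
have alE : Num.sqrt A = al by rewrite -alpha_normE.
pose Q := golden_Q s; pose Th := golden_Theta b2 s; pose Ps := golden_Psi b2 s.
pose r := - 2 * al * Q * s_0 a b x y + r_00 a b x y.
rewrite -/Q -/Th -/Ps -/r.
pose H i := Gal i + (al * Q * s_u0 a b x y i
  + r * Ps * b_up a b x i + r * Th * al^-1 * y 0 i).
transitivity (H i); last by rewrite /H; ring.
apply: spray_unique => [|l]; first exact: fundamental_tensor_golden_unit.
have dotH u : dot u H = dot u Gal + al * Q * dot u (s_u0 a b x y)
    + r * Ps * dot u (b_up a b x) + r * Th * al^-1 * dot u (y 0).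
  by rewrite [LHS]dotDr dot_lin3 !addrA.
have aH : lower (a x) H l = lower (a x) Gal l + al * Q * S l
    + r * Ps * b x 0 l + r * Th * al^-1 * Y l.
  by rewrite -lower_s_u0 -lower_b_up; exact: dotH.
rewrite fundamental_tensor_golden lower_ab_tensor aH -/Y !dotH.
rewrite dot_Y_s_u0 dot_b_s_u0 dot_Y_b_up dot_b_b_up dot_Y_y dot_b_y.
rewrite euler_lagrange_golden -/Y.
set D := \sum_k _.
(* All derivatives of [a] and [b] are absorbed into [Gal], [r_00] and [S], except two terms in
   direction [l], which cancel against the x-derivative subtracted from [D]. *)
have -> : D = (sqF_AA A B * (4 * dot Y Gal)
      + sqF_AB A B * (r_00 a b x y + 2 * dot (b x 0) Gal)) * (2 * Y l)
    + sqF_A A B * (4 * lower (a x) Gal l + quad (Da l) y)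
    + (sqF_AB A B * (4 * dot Y Gal)
      + sqF_BB A B * (r_00 a b x y + 2 * dot (b x 0) Gal)) * b x 0 l
    + sqF_B A B * (2 * S l + dot (Db l) (y 0)).
  rewrite lower_spray_alpha mulVKf // subrK -form_curl subrK.
  rewrite -sum_quad_metric_partial -sum_form_partial.
  transitivity (\sum_k
      ((sqF_AA A B * (2 * Y l) + sqF_AB A B * b x 0 l) * (quad (Da k) y * y 0 k)
     + (sqF_AB A B * (2 * Y l) + sqF_BB A B * b x 0 l)
         * (dot (Db k) (y 0) * y 0 k)
     + sqF_A A B * (2 * lower (Da k) (y 0) l * y 0 k)
     + sqF_B A B * (Db k l * y 0 k))).
    by apply: eq_bigr => k _; ring.
  by rewrite !big_split /= -!mulr_sumr; ring.
(* The terms in [Gal] agree on both sides; what is left is a rational identity in [al], [s] and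
   [b2], with [r_00], [s_0], [S l], [Y l] and b_l as free variables. *)
rewrite /sqF_A /sqF_AA /sqF_AB /sqF_BB /sqF_B sE alE AE beta_ratio.
rewrite /r /Ps /Th /Q /golden_Q /golden_Psi /golden_Theta -/b2.
move: z_neq0 phi_neq0 sqrs1_neq0; rewrite /golden_z => z0 phi0 s0.
by field; rewrite al0 z0 phi0 s0.
Qed.
End LocalSpray.

(** * From local coordinates to tensor fields on the manifold *)

Lemma smooth_on_derivable (R : realType) (n : nat) (U : set 'rV[R]_n)
    (f : 'rV[R]_n -> R) (x : 'rV[R]_n) (k : 'I_n) :
  smooth_on U f -> U x -> derivable f x (delta_mx 0 k).
Proof. by move=> /(_ 1%N) [_ Df _] Ux; exact: Df. Qed.

Unset Implicit Arguments.

Theorem proposition2p5 (R : realType) (n : nat) (M : smoothManifold R n)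
    (alpha : riemannianMetric M) (beta : oneForm M)
    (c : chart R M n) (hc : atlas c)
    (x y : 'rV[R]_n) (hx : chart_img c x) (hy : y != 0) :
  let a := alpha c in
  let b := beta c in
  let al := alpha_norm a x y in
  let s := ab_ratio a b x y in
  let b2 := b_sq a b x in
  s ^+ 2 - s - 1 != 0 ->
  golden_z b2 s != 0 ->
  forall i : 'I_n,
    spray (golden_metric a b) x y i =
      spray (alpha_norm a) x y i
      + al * golden_Q s * s_u0 a b x y i
      + (- 2 * al * golden_Q s * s_0 a b x y + r_00 a b x y)
        * (golden_Psi b2 s * b_up a b x i
           + golden_Theta b2 s * al^-1 * y 0 i).
Proof.
move=> a b al s b2 phi_neq0 z_neq0 i.
apply: (@golden_spray R n a b (chart_img c)) => //.
- exact: chart_img_open.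
- by move=> u Uu j k; exact: (Defs.metric_sym alpha hc Uu).
- by move=> u Uu v v0; rewrite quadE; exact: (metric_posdef alpha hc Uu).
- by move=> j k l; exact: smooth_on_derivable (metric_smooth alpha hc j k) hx.
- by move=> j k; exact: smooth_on_derivable (form_smooth beta hc j) hx.
Qed.
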